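(* Let $\Bbbk$ be a field and let $\mathcal A=\{H_1,\dots,H_n\}$ be a central arrangement of $n$ distinct linear hyperplanes in $\mathbb C^\ell$ with underlying matroid $\mathfrak G$. Then $$\mathcal R(\mathcal A,\Bbbk)=\bigcup_{\Gamma\in \mathcal N(\mathfrak G,\Bbbk)} V(\Gamma,\Bbbk).$$
   Context: Write $[n]=\{1,\dots,n\}$. The matroid $\mathfrak G$ is the matroid on $[n]$ whose circuits are the minimal sets $C\subseteq[n]$ with $\operatorname{codim}(\bigcap_{i\in C}H_i)<|C|$. The Orlik-Solomon algebra $A=A_\Bbbk(\mathfrak G)$ is the quotient of the exterior algebra over $\Bbbk$ on degree-one generators $e_1,\dots,e_n$ by the ideal generated by all $\partial e_C=\sum_{j=1}^p(-1)^{j-1}e_{i_1}\cdots\hat e_{i_j}\cdots e_{i_p}$, for $C=\{i_1,\dots,i_p\}$ a circuit. The image of $e_i$ in $A$ is $a_i$. For $\xi\in\Bbbk^n$ put $a_\xi=\sum_i\xi_ia_i$. For $\lambda\in\Bbbk^n$ let $Z(\lambda,\Bbbk)=\{\eta\in\Bbbk^n: a_\lambda a_\eta=0\}$. The (degree-one) resonance variety is $\mathcal R(\mathcal A,\Bbbk)=\{\lambda\in\Bbbk^n:\dim_\Bbbk Z(\lambda,\Bbbk)\ge 2\}$. A line of $\mathfrak G$ is a rank-two flat, i.e. a set $\{m\in[n]: H_m\supseteq H_i\cap H_j\}$ with $i\ne j$; $\mathcal X(\mathfrak G)$ is the set of lines, and $\mathcal X_0(\mathfrak G)$ is the set of lines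 $X$ with $|X|\ge3$ (nontrivial lines). For $S\subseteq[n]$ and $\xi\in\Bbbk^n$, $\xi_S=\sum_{i\in S}\xi_i$. Let $\Gamma$ be a (simple) graph with vertex set $[n]$. A clique is a set of pairwise adjacent vertices; a block is a maximal clique; a cone vertex is a vertex adjacent to every other vertex. Let $U$ be the set of non-cone vertices of $\Gamma$. $\Gamma$ is $\mathfrak G$-neighborly if for every $X\in\mathcal X(\mathfrak G)$ with $|X\cap U|\ge 2$ and every block $S$ of $\Gamma$, $|X\cap U\cap S|\ge|X\cap U|-1$ implies $X\subseteq S$. Let $\mathcal X_\Gamma(\mathfrak G)=\{X\in\mathcal X_0(\mathfrak G): X\text{ is not a clique of }\Gamma\}$ and $K(\Gamma,\Bbbk)=\{\xi\in\Bbbk^n:\xi_X=0\text{ for every }X\in\mathcal X_\Gamma(\mathfrak G)\}$. For $\lambda\in K(\Gamma,\Bbbk)$ let $Z_\Gamma(\lambda,\Bbbk)=\{\eta\in K(\Gamma,\Bbbk):\lambda_i\eta_j-\lambda_j\eta_i=0\text{ for every edge }\{i,j\}\text{ of }\Gamma\}$, a linear subspace. $\mathcal N(\mathfrak G,\Bbbk)$ is the set of $\mathfrak G$-neighborly graphs $\Gamma$ with vertex set $[n]$ and $\dim K(\Gamma,\Bbbk)\ge2$. For $\Gamma\in\mathcal N(\mathfrak G,\Bbbk)$, $V(\Gamma,\Bbbk)=\{\lambda\in K(\Gamma,\Bbbk):\dim_\Bbbk Z_\Gamma(\lambda,\Bbbk)\ge 2\}$. *)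

(* Defs.v *)
From HB Require Import structures.
From mathcomp Require Import classical_sets reals.
From mathcomp Require Import all_boot all_order all_algebra all_field.
From mathcomp Require Import generic_quotient ring_quotient complex.

Set Implicit Arguments.
Unset Strict Implicit.
Unset Printing Implicit Defensive.

Import GRing.Theory.
Local Open Scope ring_scope.

(* The exterior algebra on degree-one generators e_1, ..., e_n, with          *)
(* coordinates in the monomial basis e_S = e_{i_1} ... e_{i_p} indexed by the *)
(* sets S = {i_1 < ... < i_p}. For disjoint S and T,                          *)
(* e_S e_T = (-1)^(inversions S T) e_{S :|: T}; otherwise e_S e_T = 0.        *)
Definition exterior (k : fieldType) (n : nat) := {ffun {set 'I_n} -> k^o}.

HB.instance Definition _ k n :=
  Vector.copy (exterior k n) {ffun {set 'I_n} -> k^o}.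

Definition inversions n (S T : {set 'I_n}) : nat :=
  (\sum_(i in S) \sum_(j in T) (j < i))%N.

Lemma setUD_subset n (S T : {set 'I_n}) : S \subset T -> S :|: (T :\: S) = T.
Proof. by move=> /setIidPr sST; rewrite -{1}sST setID. Qed.

Lemma setDU_disjoint n (S T : {set 'I_n}) :
  [disjoint S & T] -> (S :|: T) :\: S = T.
Proof.
by move=> dST; rewrite setDUl setDv set0U; apply/setDidPl; rewrite disjoint_sym.
Qed.

Lemma disjoint_setD n (S T : {set 'I_n}) : [disjoint S & T :\: S].
Proof. by rewrite disjoints_subset setCD subsetUr. Qed.

Lemma sum_setU_disjoint n (S T : {set 'I_n}) (f : 'I_n -> nat) :
  [disjoint S & T] ->
  (\sum_(i in S :|: T) f i = \sum_(i in S) f i + \sum_(i in T) f i)%N.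
Proof.
move=> dST; rewrite -bigU //=; apply: eq_bigl => i.
by rewrite !inE.
Qed.

Lemma inversionsUl n (S T U : {set 'I_n}) : [disjoint S & T] ->
  inversions (S :|: T) U = (inversions S U + inversions T U)%N.
Proof. exact: sum_setU_disjoint. Qed.

Lemma inversionsUr n (S T U : {set 'I_n}) : [disjoint T & U] ->
  inversions S (T :|: U) = (inversions S T + inversions S U)%N.
Proof.
move=> d; rewrite /inversions -big_split /=.
by apply: eq_bigr => i _; apply: sum_setU_disjoint.
Qed.

Section ExteriorAlgebra.
Variables (k : fieldType) (n : nat).
Local Notation E := (exterior k n).
Implicit Types (x y z : E) (S T U : {set 'I_n}).

Definition ext_coef x S : k := (x : {ffun {set 'I_n} -> k^o}) S.

Definition ext_mono S : E := [ffun T => (T == S)%:R].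

Definition ext_one : E := ext_mono set0.

Definition ext_mul x y : E :=
  [ffun S : {set 'I_n} => \sum_(T : {set 'I_n} | T \subset S)
     (-1) ^+ inversions T (S :\: T) * ext_coef x T * ext_coef y (S :\: T)].

Lemma extP x y : (forall S, ext_coef x S = ext_coef y S) -> x = y.
Proof. by move=> h; apply/ffunP. Qed.

Lemma ext_coefD x y S : ext_coef (x + y) S = ext_coef x S + ext_coef y S.
Proof. by rewrite /ext_coef ffunE. Qed.

Lemma ext_coefZ (a : k) x S : ext_coef (a *: x) S = a * ext_coef x S.
Proof. by rewrite /ext_coef ffunE. Qed.

Lemma ext_coef_mono S T : ext_coef (ext_mono S) T = (T == S)%:R.
Proof. by rewrite /ext_coef ffunE. Qed.

Lemma ext_coef_mul x y S : ext_coef (ext_mul x y) S =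
  \sum_(T : {set 'I_n} | T \subset S)
     (-1) ^+ inversions T (S :\: T) * ext_coef x T * ext_coef y (S :\: T).
Proof. by rewrite /ext_coef ffunE. Qed.

Lemma ext_mulA : associative ext_mul.
Proof.
move=> x y z; apply: extP => S; rewrite !ext_coef_mul.
under eq_bigr => T sTS do rewrite ext_coef_mul mulr_sumr.
under [RHS]eq_bigr => T sTS do rewrite ext_coef_mul mulr_sumr mulr_suml.
rewrite [RHS](exchange_big_dep (fun T => T \subset S)) /=; last first.
  by move=> V T sVS sTV; apply: subset_trans sTV sVS.
apply: eq_bigr => T sTS.
rewrite [RHS](reindex_onto (fun W => T :|: W) (fun V => V :\: T)) /=; last first.
  by move=> V /andP[_ sTV]; apply: setUD_subset.
have eqP (W : {set 'I_n}) : (W \subset S :\: T) =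
   ((T :|: W \subset S) && (T \subset T :|: W)) && ((T :|: W) :\: T == W).
  rewrite subsetD subUset sTS subsetUl /= andbT disjoint_sym.
  case: (W \subset S) => //=.
  by apply/idP/eqP => [/setDU_disjoint|<-] //; apply: disjoint_setD.
apply: eq_big => [//|W]; rewrite subsetD => /andP[sWS dWT].
have eW : (T :|: W) :\: T = W.
  by apply: setDU_disjoint; rewrite disjoint_sym.
have eS : S :\: (T :|: W) = S :\: T :\: W by rewrite setDDl.
have eST : S :\: T = W :|: (S :\: T :\: W).
  by rewrite setUD_subset // subsetD sWS.
have dd : [disjoint W & S :\: T :\: W] := disjoint_setD _ _.
rewrite eW eS {1}eST inversionsUr // inversionsUl; last by rewrite disjoint_sym.
rewrite !exprD !mulrA.
set a := (-1) ^+ inversions T W; set b := (-1) ^+ inversions T _.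
set c := (-1) ^+ inversions W _.
rewrite [a * b]mulrC -!mulrA; congr (_ * _).
rewrite [RHS]mulrCA; congr (_ * _); rewrite mulrCA; congr (_ * _).
Qed.

Lemma ext_mul1l : left_id ext_one ext_mul.
Proof.
move=> x; apply: extP => S; rewrite ext_coef_mul (bigD1 set0) ?sub0set //=.
rewrite big1 => [|T /andP[_ /negPf nT]].
  by rewrite ext_coef_mono eqxx setD0 /inversions big_set0 expr0 !mul1r addr0.
by rewrite ext_coef_mono nT mulr0 mul0r.
Qed.

Lemma ext_mul1r : right_id ext_one ext_mul.
Proof.
move=> x; apply: extP => S; rewrite ext_coef_mul (bigD1 S) //=.
rewrite big1 => [|T /andP[sTS nT]].
  rewrite ext_coef_mono setDv eqxx mulr1 addr0 /inversions big1 ?mul1r //.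
  by move=> i _; rewrite big_set0.
rewrite ext_coef_mono; case: eqP => [/eqP|_]; last by rewrite mulr0.
by rewrite setD_eq0 => sST; rewrite eqEsubset sTS sST in nT.
Qed.

Lemma ext_mulDl : left_distributive ext_mul +%R.
Proof.
move=> x y z; apply: extP => S; rewrite ext_coefD !ext_coef_mul -big_split /=.
by apply: eq_bigr => T _; rewrite ext_coefD mulrDr mulrDl.
Qed.

Lemma ext_mulDr : right_distributive ext_mul +%R.
Proof.
move=> x y z; apply: extP => S; rewrite ext_coefD !ext_coef_mul -big_split /=.
by apply: eq_bigr => T _; rewrite ext_coefD mulrDr.
Qed.

Lemma ext_one_neq0 : ext_one != 0.
Proof.
apply/eqP => /(congr1 (fun x => ext_coef x set0)) /eqP.
by rewrite ext_coef_mono eqxx /ext_coef ffunE oner_eq0.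
Qed.

HB.instance Definition _ := GRing.Zmodule_isNzRing.Build E
  ext_mulA ext_mul1l ext_mul1r ext_mulDl ext_mulDr ext_one_neq0.

Lemma ext_scaleAl (a : k) x y : a *: (x * y) = a *: x * y.
Proof.
apply: extP => S; rewrite ext_coefZ !ext_coef_mul mulr_sumr.
by apply: eq_bigr => T _; rewrite ext_coefZ !mulrA [a * _]mulrC.
Qed.

HB.instance Definition _ := GRing.Lmodule_isLalgebra.Build k E ext_scaleAl.

Lemma ext_scaleAr (a : k) x y : a *: (x * y) = x * (a *: y).
Proof.
apply: extP => S; rewrite ext_coefZ !ext_coef_mul mulr_sumr.
by apply: eq_bigr => T _; rewrite ext_coefZ mulrCA.
Qed.

HB.instance Definition _ := GRing.Lalgebra_isAlgebra.Build k E ext_scaleAr.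
HB.instance Definition _ := Algebra_isFalgebra.Build k E.

Definition ext_gen (i : 'I_n) : E := ext_mono [set i].

Lemma ext_monoM S T : ext_mono S * ext_mono T =
  if [disjoint S & T] then (-1) ^+ inversions S T *: ext_mono (S :|: T) else 0.
Proof.
apply: extP => U; rewrite ext_coef_mul.
have -> : ext_coef (if [disjoint S & T]
     then (-1) ^+ inversions S T *: ext_mono (S :|: T) else 0) U =
     ([disjoint S & T] && (U == S :|: T))%:R * (-1) ^+ inversions S T :> k.
  case: ifP => d /=; last by rewrite /ext_coef ffunE mul0r.
  by rewrite ext_coefZ ext_coef_mono mulrC.
rewrite (big_mkcond) (bigD1 S) //= big1 => [|V /negPf nV]; last first.
  by rewrite ext_coef_mono nV mulr0 mul0r if_same.
rewrite addr0 !ext_coef_mono eqxx mulr1.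
have -> : ([disjoint S & T] && (U == S :|: T)) =
          ((S \subset U) && (U :\: S == T)).
  apply/andP/andP => [[d /eqP ->]|[sSU /eqP <-]]; split.
  - exact: subsetUl.
  - by rewrite setDU_disjoint.
  - exact: disjoint_setD.
  - by rewrite setUD_subset.
case: (S \subset U) => /=; last by rewrite mul0r.
by case: eqP => [->|]; rewrite ?mulr1 ?mul1r ?mulr0 ?mul0r.
Qed.

Lemma ext_gen_sqr (i : 'I_n) : ext_gen i * ext_gen i = 0.
Proof. by rewrite ext_monoM ifF // disjoints1 inE eqxx. Qed.

Lemma ext_gen_anti (i j : 'I_n) :
  ext_gen i * ext_gen j = - (ext_gen j * ext_gen i).
Proof.
have [->|nij] := eqVneq i j; first by rewrite ext_gen_sqr oppr0.
rewrite !ext_monoM !disjoints1 !inE [j == i]eq_sym nij.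
rewrite /inversions !big_set1 setUC -scaleNr; congr (_ *: _).
by case: ltngtP (nij) => [|//|/ord_inj->]; rewrite ?opprK ?expr1 ?eqxx.
Qed.

(* The increasing products of the generators are the monomial basis.          *)
Lemma ext_prod_gen S : \prod_(i in S) ext_gen i = ext_mono S.
Proof.
suff: forall s : seq 'I_n, sorted (fun i j : 'I_n => (i < j)%N) s ->
    \prod_(i <- s) ext_gen i = ext_mono [set i in s].
  move=> h; rewrite -big_filter h /=.
    by congr ext_mono; apply/setP => i; rewrite inE mem_filter mem_index_enum andbT.
  apply: sorted_filter => [i j m|]; first exact: ltn_trans.
  by rewrite /index_enum unlock -enumT -(@sorted_map _ _ val ltn) val_enum_ord iota_ltn_sorted.
elim=> [|i s IH] /=; first by rewrite big_nil set_nil.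
move=> pis; rewrite big_cons IH ?(path_sorted pis) //.
have /allP his : all (fun j : 'I_n => (i < j)%N) s.
  by apply: order_path_min pis => a b c; apply: ltn_trans.
have nis : i \notin s by apply/negP => /his; rewrite ltnn.
rewrite ext_monoM disjoints1 inE nis /inversions big_set1 big1 ?scale1r.
  by congr ext_mono; apply/setP => j; rewrite !inE.
by move=> j; rewrite inE => /his; case: ltngtP.
Qed.

End ExteriorAlgebra.

Record arrangement (F : fieldType) (l n : nat) := Arrangement {
  hyperplane :> 'I_n -> {vspace 'rV[F]_l};
  hyperplane_codim1 : forall i, (\dim (hyperplane i)).+1 = l;
  hyperplane_inj : injective hyperplane
}.

Section Matroid.
Variables (F : fieldType) (l n : nat) (H : arrangement F l n).

Definition dependent (C : {set 'I_n}) : bool :=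
  (l - \dim (\bigcap_(i in C) H i) < #|C|)%N.

Definition circuit (C : {set 'I_n}) : bool := minset dependent C.

Definition lines : {set {set 'I_n}} :=
  [set X : {set 'I_n} | [exists i, exists j,
     (i != j) && (X == [set m | (H i :&: H j <= H m)%VS])]].

Definition nontrivial_lines : {set {set 'I_n}} :=
  [set X in lines | (3 <= #|X|)%N].

End Matroid.

Section OrlikSolomon.
Variables (k : fieldType) (F : fieldType) (l n : nat) (H : arrangement F l n).
Local Notation E := (exterior k n).

(* The exponent is the position of i, counted from 0, in the increasing       *)
(* enumeration of C; the product is taken in increasing order.                *)
Definition ext_boundary (C : {set 'I_n}) : E :=
  \sum_(i in C) (-1) ^+ #|[set j in C | (j < i)%N]| *:
    \prod_(j in C :\ i) ext_gen k j.

(* The product of subspaces in a finite-dimensional algebra is the span of    *)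
(* the products, so this is the two-sided ideal generated by the boundaries.  *)
Definition OS_ideal : {vspace E} :=
  ({:E} * <<[seq ext_boundary C | C : {set 'I_n} in circuit H]>> * {:E})%VS.

Lemma OS_idealMl (x y : E) : y \in OS_ideal -> x * y \in OS_ideal.
Proof.
move=> yI; apply: (subvP _ _ (memv_mul (memvf x) yI)).
by rewrite /OS_ideal !prodvA !prodvSl // subvf.
Qed.

Lemma OS_idealMr (x y : E) : x \in OS_ideal -> x * y \in OS_ideal.
Proof.
move=> xI; apply: (subvP _ _ (memv_mul xI (memvf y))).
by rewrite /OS_ideal -[X in (X <= _)%VS]prodvA prodvSr // subvf.
Qed.

Lemma circuit_card (C : {set 'I_n}) : circuit H C -> (1 < #|C|)%N.
Proof.
move=> /minsetp; rewrite /dependent.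
case: (posnP #|C|) => [C0|Cgt0]; first by rewrite C0.
have [/cards1P[i ->]|] := boolP (#|C| == 1%N); last by case: #|C| Cgt0 => [|[]].
rewrite big_set1 cards1; move: (hyperplane_codim1 H i) => dHi.
by rewrite -[X in (X - _)%N]dHi subSnn.
Qed.

Definition ext_aug (x : E) : k^o := ext_coef x set0.

Lemma ext_aug_is_linear : linear ext_aug.
Proof. by move=> a x y; rewrite /ext_aug ext_coefD ext_coefZ. Qed.

HB.instance Definition _ := GRing.isLinear.Build k E k^o *:%R ext_aug
  ext_aug_is_linear.

Lemma ext_augM (x y : E) : ext_aug (x * y) = ext_aug x * ext_aug y.
Proof.
rewrite /ext_aug ext_coef_mul (bigD1 set0) ?sub0set //= big1 => [|T].
  by rewrite addr0 setD0 /inversions big_set0 mul1r.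
by rewrite subset0 => /andP[->].
Qed.

Lemma OS_ideal_proper : (1 : E) \notin OS_ideal.
Proof.
suff sI : (OS_ideal <= lker (linfun ext_aug))%VS.
  apply/negP => /(subvP sI); rewrite memv_ker lfunE /= /ext_aug.
  by rewrite ext_coef_mono eqxx oner_eq0.
apply/prodvP => x y /= xI _; rewrite memv_ker lfunE /= ext_augM.
suff sJ : ({:E} * <<[seq ext_boundary C | C : {set 'I_n} in circuit H]>>
             <= lker (linfun ext_aug))%VS.
  by move: (subvP sJ _ xI); rewrite memv_ker lfunE /= => /eqP->; rewrite mul0r.
apply/prodvP => {xI}x {}y _ yI; rewrite memv_ker lfunE /= ext_augM.
suff sG : (<<[seq ext_boundary C | C : {set 'I_n} in circuit H]>>
             <= lker (linfun ext_aug))%VS.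
  by move: (subvP sG _ yI); rewrite memv_ker lfunE /= => /eqP->; rewrite mulr0.
apply/span_subvP => _ /imageP[C cC ->]; rewrite memv_ker lfunE /=.
rewrite /ext_boundary linear_sum big1 //= => i iC; rewrite linearZ /=.
rewrite ext_prod_gen /ext_aug ext_coef_mono.
have := circuit_card cC; rewrite (cardsD1 i) iC ltnS => C0.
by rewrite eq_sym -cards_eq0 eqn0Ngt C0 scaler0.
Qed.

Definition OS_algebra := Quotient.quot (OS_ideal : zmodClosed E).
Local Notation A := OS_algebra.

HB.instance Definition _ := EqQuotient.on A.
HB.instance Definition _ := GRing.Zmodule.on A.

Definition OS_pi (x : E) : A := \pi_A%qT x.

Lemma OS_piK : cancel (repr : A -> E) OS_pi.
Proof. exact: reprK. Qed.

Lemma OS_pi_eq (x y : E) : (OS_pi x == OS_pi y) = (x - y \in OS_ideal).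
Proof. by rewrite Quotient.idealrBE. Qed.

Lemma OS_piP (x y : E) : reflect (OS_pi x = OS_pi y) (x - y \in OS_ideal).
Proof. by rewrite -OS_pi_eq; apply: eqP. Qed.

Lemma OS_pi_zmod_morphism : zmod_morphism OS_pi.
Proof. by move=> x y; rewrite /OS_pi raddfB. Qed.

HB.instance Definition _ := GRing.isZmodMorphism.Build E A OS_pi
  OS_pi_zmod_morphism.

Lemma OS_repr_pi (x : E) : repr (OS_pi x) - x \in OS_ideal.
Proof. by rewrite -OS_pi_eq OS_piK. Qed.

Definition OS_one : A := OS_pi 1.
Definition OS_mul (u v : A) : A := OS_pi (repr u * repr v).
Definition OS_scale (a : k) (u : A) : A := OS_pi (a *: repr u).

Lemma OS_pi_mul (x y : E) : OS_mul (OS_pi x) (OS_pi y) = OS_pi (x * y).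
Proof.
apply/OS_piP; set x' := repr _; set y' := repr _.
have -> : x' * y' - x * y = (x' - x) * y' + x * (y' - y).
  by rewrite mulrBl mulrBr addrA subrK.
by apply: memvD; [apply: OS_idealMr | apply: OS_idealMl]; apply: OS_repr_pi.
Qed.

Lemma OS_pi_scale a (x : E) : OS_scale a (OS_pi x) = OS_pi (a *: x).
Proof. by apply/OS_piP; rewrite -scalerBr rpredZ ?OS_repr_pi. Qed.

Lemma OS_mulA : associative OS_mul.
Proof.
move=> u v w; rewrite -[u]OS_piK -[v]OS_piK -[w]OS_piK.
by rewrite !OS_pi_mul mulrA.
Qed.

Lemma OS_mul1l : left_id OS_one OS_mul.
Proof. by move=> u; rewrite -[u]OS_piK OS_pi_mul mul1r. Qed.

Lemma OS_mul1r : right_id OS_one OS_mul.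
Proof. by move=> u; rewrite -[u]OS_piK OS_pi_mul mulr1. Qed.

Lemma OS_mulDl : left_distributive OS_mul +%R.
Proof.
move=> u v w; rewrite -[u]OS_piK -[v]OS_piK -[w]OS_piK.
by rewrite -raddfD !OS_pi_mul mulrDl raddfD.
Qed.

Lemma OS_mulDr : right_distributive OS_mul +%R.
Proof.
move=> u v w; rewrite -[u]OS_piK -[v]OS_piK -[w]OS_piK.
by rewrite -raddfD !OS_pi_mul mulrDr raddfD.
Qed.

Lemma OS_one_neq0 : OS_one != 0.
Proof. by rewrite -(raddf0 OS_pi) OS_pi_eq subr0 OS_ideal_proper. Qed.

HB.instance Definition _ := GRing.Zmodule_isNzRing.Build A
  OS_mulA OS_mul1l OS_mul1r OS_mulDl OS_mulDr OS_one_neq0.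

Lemma OS_scaleA a b u : OS_scale a (OS_scale b u) = OS_scale (a * b) u.
Proof. by rewrite -[u]OS_piK !OS_pi_scale scalerA. Qed.

Lemma OS_scale1 : left_id 1 OS_scale.
Proof. by move=> u; rewrite -[u]OS_piK OS_pi_scale scale1r. Qed.

Lemma OS_scaleDr : right_distributive OS_scale +%R.
Proof.
move=> a u v; rewrite -[u]OS_piK -[v]OS_piK.
by rewrite -raddfD !OS_pi_scale scalerDr raddfD.
Qed.

Lemma OS_scaleDl u : {morph OS_scale^~ u : a b / a + b}.
Proof. by move=> a b; rewrite -[u]OS_piK !OS_pi_scale scalerDl raddfD. Qed.

HB.instance Definition _ := GRing.Zmodule_isLmodule.Build k A
  OS_scaleA OS_scale1 OS_scaleDr OS_scaleDl.

Lemma OS_scaleAl (a : k) (u v : A) : a *: (u * v) = a *: u * v.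
Proof.
rewrite -[u]OS_piK -[v]OS_piK; change (OS_scale a (OS_mul (OS_pi (repr u))
  (OS_pi (repr v))) = OS_mul (OS_scale a (OS_pi (repr u))) (OS_pi (repr v))).
by rewrite OS_pi_scale !OS_pi_mul OS_pi_scale scalerAl.
Qed.

HB.instance Definition _ := GRing.Lmodule_isLalgebra.Build k A OS_scaleAl.

Lemma OS_scaleAr (a : k) (u v : A) : a *: (u * v) = u * (a *: v).
Proof.
rewrite -[u]OS_piK -[v]OS_piK; change (OS_scale a (OS_mul (OS_pi (repr u))
  (OS_pi (repr v))) = OS_mul (OS_pi (repr u)) (OS_scale a (OS_pi (repr v)))).
by rewrite OS_pi_scale !OS_pi_mul OS_pi_scale scalerAr.
Qed.

HB.instance Definition _ := GRing.Lalgebra_isAlgebra.Build k A OS_scaleAr.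

Lemma OS_pi_is_monoid_morphism : monoid_morphism OS_pi.
Proof. by split=> // x y; rewrite -OS_pi_mul. Qed.

HB.instance Definition _ := GRing.isMonoidMorphism.Build E A OS_pi
  OS_pi_is_monoid_morphism.

Lemma OS_pi_is_scalable : scalable OS_pi.
Proof. by move=> a x; rewrite -OS_pi_scale. Qed.

HB.instance Definition _ := GRing.isScalable.Build k E A *:%R OS_pi
  OS_pi_is_scalable.

Lemma OS_pi_eq0 (x : E) : (OS_pi x == 0) = (x \in OS_ideal).
Proof. by rewrite -(linear0 OS_pi) OS_pi_eq subr0. Qed.

(* A is isomorphic to the complement of the ideal, hence finite-dimensional.  *)
Let C := (OS_ideal^C)%VS.

Lemma OS_vect_axiom : Vector.axiom (\dim C) A.
Proof.
pose p := (\1 - projv OS_ideal)%VF : 'End(E).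
have pE x : p x = x - projv OS_ideal x by rewrite add_lfunE opp_lfunE id_lfunE.
have p_pi x : p (repr (OS_pi x)) = p x.
  apply/eqP; rewrite -subr_eq0 -linearB /= pE subr_eq0 eq_sym.
  by apply/eqP/projv_id/OS_repr_pi.
have pi_p x : OS_pi (p x) = OS_pi x.
  by apply/OS_piP; rewrite pE addrAC subrr sub0r memvN memv_proj.
pose f (u : A) : subvs_of C := vsproj C (p (repr u)).
have pC x : p x \in C by rewrite pE memv_projC.
have f_pi x : f (OS_pi x) = vsproj C (p x) by rewrite /f p_pi.
have f_lin : linear f.
  move=> a u v; rewrite -[u]OS_piK -[v]OS_piK.
  by rewrite -linearP !f_pi !linearP.
have f_bij : bijective f.
  exists (fun w => OS_pi (vsval w)) => [u|w].
    by rewrite /f vsprojK // pi_p OS_piK.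
  rewrite f_pi; apply: val_inj; rewrite /= vsprojK // pE.
  suff -> : projv OS_ideal (vsval w) = 0 by rewrite subr0.
  have : vsval w \in lker (projv OS_ideal) by rewrite lker_proj subvsP.
  by rewrite memv_ker => /eqP.
have [g g_lin g_bij] := subvs_vect_iso C.
exists (g \o f); last exact: bij_comp.
by move=> a u v; rewrite /= f_lin g_lin.
Qed.

HB.instance Definition _ := Lmodule_hasFinDim.Build k A OS_vect_axiom.

Definition OS_gen (i : 'I_n) : A := OS_pi (ext_gen k i).

Definition OS_lin (xi : 'rV[k]_n) : A := \sum_(i < n) xi 0 i *: OS_gen i.

Definition OS_lmul (lambda eta : 'rV[k]_n) : A := OS_lin lambda * OS_lin eta.

Lemma OS_lmul_is_linear lambda : linear (OS_lmul lambda).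
Proof.
move=> a x y; rewrite /OS_lmul scalerAr -mulrDr; congr (_ * _).
rewrite /OS_lin scaler_sumr -big_split /=; apply: eq_bigr => i _.
by rewrite !mxE scalerDl scalerA.
Qed.

HB.instance Definition _ lambda := GRing.isLinear.Build k 'rV[k]_n A *:%R
  (OS_lmul lambda) (OS_lmul_is_linear lambda).

Definition Zspace (lambda : 'rV[k]_n) : {vspace 'rV[k]_n} :=
  lker (linfun (OS_lmul lambda)).

Lemma mem_Zspace lambda eta :
  (eta \in Zspace lambda) = (OS_lin lambda * OS_lin eta == 0).
Proof. by rewrite memv_ker lfunE. Qed.

Definition resonance : set 'rV[k]_n :=
  [set lambda | (2 <= \dim (Zspace lambda))%N]%classic.

End OrlikSolomon.

Arguments resonance k {F l n} H _.

Record sgraph (n : nat) := SGraph {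
  adj :> 'I_n -> 'I_n -> bool;
  adj_sym : symmetric adj;
  adj_irr : irreflexive adj
}.

Section Graphs.
Variables (n : nat) (G : sgraph n).

Definition clique (S : {set 'I_n}) : bool :=
  [forall i in S, forall j in S, (i != j) ==> G i j].

Definition block (S : {set 'I_n}) : bool := maxset clique S.

Definition cone_vertex (i : 'I_n) : bool := [forall j, (j != i) ==> G i j].

Definition noncone : {set 'I_n} := [set i | ~~ cone_vertex i].

End Graphs.

Section Neighborly.
Variables (k F : fieldType) (l n : nat) (H : arrangement F l n).
Variable G : sgraph n.

Definition neighborly : Prop :=
  forall X S : {set 'I_n}, X \in lines H -> (2 <= #|X :&: noncone G|)%N ->
    block G S ->
    (#|X :&: noncone G| - 1 <= #|X :&: noncone G :&: S|)%N -> X \subset S.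

Definition noncliques : {set {set 'I_n}} :=
  [set X in nontrivial_lines H | ~~ clique G X].

Definition sum_on (X : {set 'I_n}) (xi : 'rV[k]_n) : k^o :=
  \sum_(i in X) xi 0 i.

Lemma sum_on_is_linear X : linear (sum_on X).
Proof.
move=> a x y; rewrite /sum_on scaler_sumr -big_split /=.
by apply: eq_bigr => i _; rewrite !mxE.
Qed.

HB.instance Definition _ X := GRing.isLinear.Build k 'rV[k]_n k^o *:%R
  (sum_on X) (sum_on_is_linear X).

Definition Kspace : {vspace 'rV[k]_n} :=
  (\bigcap_(X in noncliques) lker (linfun (sum_on X)))%VS.

Lemma mem_Kspace (xi : 'rV[k]_n) :
  reflect (forall X, X \in noncliques -> \sum_(i in X) xi 0 i = 0) (xi \in Kspace).
Proof.
apply: (iffP idP) => [/subv_bigcapP h X XN|h].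
  by move: (h X XN); rewrite -memvE memv_ker lfunE => /eqP.
apply/subv_bigcapP => X XN.
by move: (h X XN); rewrite -memvE memv_ker lfunE => /eqP.
Qed.

Definition minor2 (lambda : 'rV[k]_n) (i j : 'I_n) (eta : 'rV[k]_n) : k^o :=
  lambda 0 i * eta 0 j - lambda 0 j * eta 0 i.

Lemma minor2_is_linear lambda i j : linear (minor2 lambda i j).
Proof.
move=> a x y; rewrite /minor2 !mxE !mulrDr scalerBr /GRing.scale /= opprD.
by rewrite !mulrA ![lambda _ _ * a]mulrC addrACA.
Qed.

HB.instance Definition _ lambda i j := GRing.isLinear.Build k 'rV[k]_n k^o
  *:%R (minor2 lambda i j) (minor2_is_linear lambda i j).

Definition Zgraph (lambda : 'rV[k]_n) : {vspace 'rV[k]_n} :=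
  (Kspace :&: \bigcap_(p : 'I_n * 'I_n | G p.1 p.2)
           lker (linfun (minor2 lambda p.1 p.2)))%VS.

Lemma mem_Zgraph (lambda eta : 'rV[k]_n) :
  reflect (eta \in Kspace /\
           forall i j, G i j -> lambda 0 i * eta 0 j - lambda 0 j * eta 0 i = 0)
          (eta \in Zgraph lambda).
Proof.
rewrite memv_cap; apply: (iffP andP) => -[eK h]; split => //.
  move=> i j Gij; move/subv_bigcapP: h => /(_ (i, j) Gij).
  by rewrite -memvE memv_ker lfunE => /eqP.
rewrite memvE; apply/subv_bigcapP => -[i j] /= Gij.
by rewrite -memvE memv_ker lfunE; apply/eqP/h.
Qed.

Definition Vset : set 'rV[k]_n :=
  [set lambda | lambda \in Kspace /\ (2 <= \dim (Zgraph lambda))%N]%classic.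

End Neighborly.

Arguments Vset k {F l n} H G _.

Definition neighborly_graphs (k F : fieldType) (l n : nat)
    (H : arrangement F l n) : set (sgraph n) :=
  [set G | neighborly H G /\ (2 <= \dim (Kspace k H G))%N]%classic.

(* Main.v *)
(* The degree-two part of the Orlik-Solomon algebra splits over the lines [X]  *)
(* of the matroid. Hence [a_lambda a_eta = 0] if and only if                  *)
(* [lambda_X eta_i = lambda_i eta_X] for every line [X] and every [i] in [X]. *)
(* One implication uses functionals on the degree-two part of the exterior    *)
(* algebra that vanish on the ideal; the other uses                           *)
(* [(a_b - a_a)(a_c - a_a) = 0] for [a], [b], [c] on a line.                  *)
(* Given [lambda], join [i] and [j] if [lambda_i eta_j = lambda_j eta_i] for  *)
(* all [eta] in [Z = Z(lambda)]. A line that is not a clique satisfies        *)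
(* [eta_X = 0] on [Z], so [Z] lies in [K] and in [Z_Gamma(lambda)]. On the    *)
(* non-cone vertices adjacency is transitive, and if all points of such a     *)
(* line but one are proportional, [eta_X = 0] forces the last one to be so;   *)
(* this makes the graph neighborly. Conversely, for a neighborly graph the    *)
(* line relations hold on [Z_Gamma(lambda)].                                  *)
From HB Require Import structures.
Require Import Defs.
From mathcomp Require Import classical_sets reals.
From mathcomp Require Import all_boot all_order all_algebra falgebra complex zify ring.

Set Implicit Arguments.
Unset Strict Implicit.
Unset Printing Implicit Defensive.

Import GRing.Theory.
Local Open Scope ring_scope.

(** Everything rests on the linear criterion [mem_Zspace_lines]: [eta] annihilates [lambda] exactly
    when [sum_on X lambda * eta 0 i = lambda 0 i * sum_on X eta] at every point [i] of every line
    [X]. Both inclusions then compare subspaces for a fixed [lambda]. For a neighborly graph with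
    [lambda] in [Kspace], [Zgraph_sub_Zspace] puts [Zgraph] inside [Zspace]. Conversely,
    [resonance_graph lambda] is built so that [Zspace] lies in both [Kspace] and [Zgraph]; since
    [lambda] is itself in [Zspace], all membership and dimension conditions follow. The delicate
    point is [neighborly_resonance_graph], which needs proportionality to be transitive through
    non-cone vertices ([proportional_trans]). *)

Section Lines.
Variables (F : fieldType) (l n : nat) (H : arrangement F l n).
Implicit Types (i j a b c : 'I_n) (X Y C : {set 'I_n}).

(** * Rank-two flats and three-element circuits *)

Lemma dim_hyperplane2 i j : i != j -> ((\dim (H i :&: H j)).+2 = l)%N.
Proof.
move=> nij.
have hi := hyperplane_codim1 H i; have hj := hyperplane_codim1 H j.
have ne : (\dim (H i) < \dim (H i + H j))%N.
  rewrite ltn_neqAle dimvS ?addvSl // andbT; apply/negP => e.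
  have /eqP eij : H i == (H i + H j)%VS by rewrite eqEdim addvSl -(eqP e) /=.
  have sji : (H j <= H i)%VS by rewrite eij addvSr.
  have /eqP/hyperplane_inj eji : H j == H i.
    by rewrite eqEdim sji -ltnS hi hj leqnn.
  by rewrite eji eqxx in nij.
have le : (\dim (H i + H j) <= l)%N.
  by rewrite (leq_trans (dimvS (subvf _))) // dimvf /dim /= mul1n.
move: (dimv_sum_cap (H i) (H j)) hi hj ne le; lia.
Qed.

Definition line_of i j := [set m | (H i :&: H j <= H m)%VS].

Lemma line_of_lines i j : i != j -> line_of i j \in lines H.
Proof.
by move=> nij; rewrite inE; apply/existsP; exists i; apply/existsP; exists j;
  rewrite nij eqxx.
Qed.

Lemma linesP X : X \in lines H -> exists i j, i != j /\ X = line_of i j.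
Proof.
by rewrite inE => /existsP[i /existsP[j /andP[nij /eqP eX]]]; exists i, j.
Qed.

Lemma mem_line_ofl i j : i \in line_of i j.
Proof. by rewrite inE capvSl. Qed.

Lemma mem_line_ofr i j : j \in line_of i j.
Proof. by rewrite inE capvSr. Qed.

(** The codimension-two space defining [X] lies in [H i :&: H j], which has the same dimension, so
    the two coincide. *)
Lemma lines_eq_line_of X i j :
  X \in lines H -> i \in X -> j \in X -> i != j -> X = line_of i j.
Proof.
move=> /linesP[a [b [nab ->]]] iX jX nij.
have /eqP e : (H a :&: H b)%VS == (H i :&: H j)%VS.
  rewrite eqEdim subv_cap; move: iX jX; rewrite !inE => -> -> /=.
  by rewrite -ltnS -ltnS dim_hyperplane2 // dim_hyperplane2.
by apply/setP => m; rewrite !inE e.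
Qed.

Lemma dependent_pair i j : i != j -> ~~ dependent H [set i; j].
Proof.
move=> nij; rewrite /dependent cards2 nij big_setU1 ?inE //= big_set1.
by move: (dim_hyperplane2 nij); lia.
Qed.

(** Distinct hyperplanes give a matroid without loops or parallel pairs. Hence circuit boundaries
    have no component in degree below two. *)
Lemma circuit_card3 C : circuit H C -> (2 < #|C|)%N.
Proof.
move=> cC; rewrite ltn_neqAle (circuit_card cC) andbT; apply/negP => C2.
have /cards2P[i [j [nij eC]]] : #|C| == 2 by rewrite eq_sym.
by move: cC; rewrite eC => /minsetp; apply/negP/dependent_pair.
Qed.

Lemma dependent_triple a b c : a != b -> a != c -> b != c ->
  dependent H [set a; b; c] = (c \in line_of a b).
Proof.
move=> nab nac nbc.
have nC : c \notin [set a; b] by rewrite !inE negb_or ![c == _]eq_sym nac nbc.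
have d := dim_hyperplane2 nab.
have eq : (\bigcap_(i in [set a; b; c]) H i)%VS = (H a :&: H b :&: H c)%VS.
  by rewrite setUC big_setU1 //= big_setU1 ?inE //= big_set1 capvC.
rewrite /dependent setUC cardsU1 nC cards2 nab setUC eq inE.
apply/idP/idP => [lt|s].
  have /eqP <- : (H a :&: H b :&: H c)%VS == (H a :&: H b)%VS.
    by rewrite eqEdim capvSl /=; lia.
  exact: capvSr.
by move/capv_idPl: s => ->; lia.
Qed.

Lemma circuit_triple a b c : a != b -> a != c -> b != c ->
  circuit H [set a; b; c] = (c \in line_of a b).
Proof.
move=> nab nac nbc; apply/idP/idP => [/minsetp|cab].
  by rewrite dependent_triple.
apply/minsetP; split=> [|B dB sB]; first by rewrite dependent_triple.
have nC : c \notin [set a; b] by rewrite !inE negb_or ![c == _]eq_sym nac nbc.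
apply/eqP; rewrite eqEcard sB /= setUC cardsU1 nC cards2 nab add1n.
have [D cD sDB] := minset_exists dB.
exact: leq_trans (circuit_card3 cD) (subset_leq_card sDB).
Qed.

End Lines.

(** * Degree-two coordinates in the exterior algebra *)

Section Exterior.
Variables (k : fieldType) (n : nat).
Local Notation E := (exterior k n).
Local Notation e := (ext_gen k).
Implicit Types (x y z : E) (i j a b c : 'I_n) (S T X C : {set 'I_n}).
Implicit Types (lambda eta xi : 'rV[k]_n).

Lemma sum_setU2 (V : nmodType) (f : 'I_n -> V) i j : i != j ->
  \sum_(m in [set i; j]) f m = f i + f j.
Proof. by move=> nij; rewrite big_setU1 ?inE //= big_set1. Qed.

Lemma sum_setU3 (V : nmodType) (f : 'I_n -> V) a b c :
  a != b -> a != c -> b != c ->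
  \sum_(m in [set a; b; c]) f m = f a + f b + f c.
Proof.
move=> nab nac nbc; rewrite setUC big_setU1 /= ?sum_setU2 1?addrC //.
by rewrite !inE negb_or ![c == _]eq_sym nac nbc.
Qed.

Lemma inversions1 i j : inversions [set i] [set j] = (j < i)%N.
Proof. by rewrite /inversions !big_set1. Qed.

Lemma sign_swap i j : i != j -> (-1) ^+ (i < j)%N = - (-1) ^+ (j < i)%N :> k.
Proof. by case: (ltngtP i j) => [_|_|/ord_inj->]; rewrite ?opprK ?eqxx. Qed.

Lemma ext_genM i j : i != j ->
  e i * e j = (-1) ^+ (j < i)%N *: ext_mono k [set i; j] :> E.
Proof. by move=> nij; rewrite ext_monoM disjoints1 inE nij inversions1. Qed.

(* For [a < b < c] the boundary expands to [(e_b - e_a)(e_c - e_a)], and this *)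
(* product is antisymmetric in [a], [b], [c].                                 *)
Lemma ext_boundary_triple a b c : a != b -> a != c -> b != c ->
  ext_boundary k [set a; b; c] =
    (-1) ^+ ((b < a)%N + (c < a)%N + (c < b)%N) *:
      ((e b - e a) * (e c - e a)) :> E.
Proof.
move=> nab nac nbc; rewrite /ext_boundary sum_setU3 // !ext_prod_gen.
have card_lt i : #|[set j in [set a; b; c] | (j < i)%N]| =
    ((a < i)%N + (b < i)%N + (c < i)%N)%N.
  transitivity (\sum_(j in [set a; b; c]) (j < i : nat))%N; last first.
    exact: (sum_setU3 (fun j : 'I_n => (j < i : nat)%N)).
  rewrite -sum1_card [RHS]big_mkcond [LHS]big_mkcond; apply: eq_bigr => j _.
  by rewrite in_set; case: (j \in [set a; b; c]); case: (j < i)%N.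
have -> : [set a; b; c] :\ a = [set b; c].
  by apply/setP => m; rewrite !inE; case: (eqVneq m a) => // ->;
    rewrite (negPf nab) (negPf nac).
have -> : [set a; b; c] :\ b = [set a; c].
  by apply/setP => m; rewrite !inE; case: (eqVneq m b) => [->|_];
    rewrite ?orbF // [b == a]eq_sym (negPf nab) (negPf nbc).
have -> : [set a; b; c] :\ c = [set a; b].
  by apply/setP => m; rewrite !inE; case: (eqVneq m c) => [->|_];
    rewrite ?orbF ?[c == _]eq_sym ?(negPf nac) ?(negPf nbc).
rewrite !card_lt !ltnn !mulrBl !mulrBr ext_gen_sqr subr0 [e b * e a]ext_gen_anti.
rewrite !ext_genM //.
have ltC i j : i != j -> (i < j)%N = ~~ (j < i)%N.
  by move=> nij; rewrite -leqNgt ltn_neqAle nij.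
(* All signs now depend on three booleans, and each of the eight cases is a ring identity between
   coefficients. *)
rewrite (ltC a b) // (ltC a c) // (ltC b c) //.
apply: extP => S; rewrite -!scaleN1r !(ext_coefD, ext_coefZ).
by case: (b < a)%N; case: (c < a)%N; case: (c < b)%N => /=; ring.
Qed.

Definition ext_lin xi : E := \sum_(i < n) xi 0 i *: e i.

Lemma ext_coef_sum (I : finType) (P : pred I) (x : I -> E) S :
  ext_coef (\sum_(i | P i) x i) S = \sum_(i | P i) ext_coef (x i) S.
Proof.
by apply: (big_morph (fun y : E => ext_coef y S)) => [y z|];
  rewrite ?ext_coefD // /ext_coef ffunE.
Qed.

Lemma ext_coef_lin xi S :
  ext_coef (ext_lin xi) S = \sum_(i < n) xi 0 i * (S == [set i])%:R.
Proof.
rewrite ext_coef_sum; apply: eq_bigr => i _.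
by rewrite ext_coefZ ext_coef_mono.
Qed.

Lemma ext_coef_lin1 xi i : ext_coef (ext_lin xi) [set i] = xi 0 i.
Proof.
rewrite ext_coef_lin (bigD1 i) //= eqxx mulr1 big1 ?addr0 // => j nji.
by rewrite (inj_eq set1_inj) eq_sym (negPf nji) mulr0.
Qed.

Lemma ext_coef_lin0 xi S : #|S| != 1%N -> ext_coef (ext_lin xi) S = 0.
Proof.
move=> S1; rewrite ext_coef_lin big1 // => i _.
by case: (eqVneq S [set i]) S1 => [->|]; rewrite ?cards1 ?mulr0.
Qed.

Lemma ext_coef_linM lambda eta i j : i != j ->
  ext_coef (ext_lin lambda * ext_lin eta) [set i; j] =
    (-1) ^+ (j < i)%N * (lambda 0 i * eta 0 j - lambda 0 j * eta 0 i).
Proof.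
move=> nij; rewrite ext_coef_mul.
have si : [set i] \subset [set i; j] by rewrite sub1set set21.
have sj : [set j] \subset [set i; j] by rewrite sub1set set22.
rewrite (bigD1 [set i]) //= (bigD1 [set j]) /=; last first.
  by rewrite sj (inj_eq set1_inj) eq_sym.
have -> : [set i; j] :\: [set i] = [set j].
  by apply: setDU_disjoint; rewrite disjoints1 inE.
have -> : [set i; j] :\: [set j] = [set i].
  by rewrite setUC; apply: setDU_disjoint; rewrite disjoints1 inE eq_sym.
rewrite !inversions1 !ext_coef_lin1 big1 ?addr0 => [|T /andP[/andP[sT nTi] nTj]].
  by rewrite (sign_swap nij); ring.
have [/cards1P[m eT]|T1] := boolP (#|T| == 1%N); last first.
  by rewrite ext_coef_lin0 // mulr0 mul0r.
move: sT nTi nTj; rewrite eT sub1set !inE !(inj_eq set1_inj).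
by case: eqP => // _; case: eqP.
Qed.

(** * Functionals on degree two and the two-sided ideals they cut out *)

Definition low_vanish x := forall S, (#|S| < 2)%N -> ext_coef x S = 0.

Lemma low_vanishMl x y : low_vanish y -> low_vanish (x * y).
Proof.
move=> y0 S S2; rewrite ext_coef_mul big1 // => T sT.
rewrite y0 ?mulr0 //; apply: leq_ltn_trans S2.
by apply: subset_leq_card; apply: subsetDl.
Qed.

(** A nonempty part of [S] taken by [x] leaves fewer than two elements for [y], so in degree two [x]
    acts through its constant term. *)
Lemma ext_coef_mul2l x y S : low_vanish y -> #|S| = 2%N ->
  ext_coef (x * y) S = ext_aug x * ext_coef y S.
Proof.
move=> y0 S2; rewrite ext_coef_mul (bigD1 set0) ?sub0set //= big1 => [|T].
  by rewrite addr0 setD0 /inversions big_set0 mul1r.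
case/andP=> sT nT; rewrite y0 ?mulr0 //.
have := cardsID T S; rewrite (setIidPr sT) S2; move: nT; rewrite -card_gt0; lia.
Qed.

Lemma ext_coef_mul2r x y S : low_vanish x -> #|S| = 2%N ->
  ext_coef (x * y) S = ext_coef x S * ext_aug y.
Proof.
move=> x0 S2; rewrite ext_coef_mul (bigD1 S) //= big1 => [|T].
  by rewrite addr0 setDv /inversions big1 ?mul1r // => i _; rewrite big_set0.
case/andP=> sT nT; rewrite x0 ?mulr0 ?mul0r //.
by rewrite -S2 proper_card // properEneq nT.
Qed.

Lemma ext_coef_boundary C S : ext_coef (ext_boundary k C) S =
  \sum_(i in C) (-1) ^+ #|[set j in C | (j < i)%N]| * (S == C :\ i)%:R.
Proof.
rewrite ext_coef_sum; apply: eq_bigr => i _.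
by rewrite ext_coefZ ext_prod_gen ext_coef_mono.
Qed.

Lemma ext_coef_boundary0 C S : #|C| != #|S|.+1 ->
  ext_coef (ext_boundary k C) S = 0.
Proof.
move=> CS; rewrite ext_coef_boundary big1 // => i iC.
case: (eqVneq S (C :\ i)) CS => [->|]; rewrite ?mulr0 //.
by rewrite (cardsD1 i C) iC eqxx.
Qed.

(* The functional on degree two sending [e_a e_b] to                          *)
(* [(a \in X) * (b == i) - (b \in X) * (a == i)].                             *)
Definition line_form X i x : k :=
  \sum_(j in X | j != i) (-1) ^+ (i < j)%N * ext_coef x [set j; i].

Lemma line_form_lin X i lambda eta : i \in X ->
  line_form X i (ext_lin lambda * ext_lin eta) =
    sum_on X lambda * eta 0 i - lambda 0 i * sum_on X eta.
Proof.
move=> iX; transitivity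
    (\sum_(j in X) (lambda 0 j * eta 0 i - lambda 0 i * eta 0 j)); last first.
  by rewrite sumrB /sum_on -mulr_suml -mulr_sumr.
rewrite [RHS](bigD1 i) //= subrr add0r; apply: eq_bigr => j /andP[_ nji].
by rewrite ext_coef_linM // mulrA -signr_addb addbb mul1r.
Qed.

Lemma line_form_is_linear X i : linear (line_form X i : E -> k^o).
Proof.
move=> r x y; rewrite /line_form scaler_sumr -big_split /=.
apply: eq_bigr => j _.
by rewrite ext_coefD ext_coefZ mulrDr /GRing.scale /= mulrCA.
Qed.

Lemma line_formZ X i (r : k) x : line_form X i (r *: x) = r * line_form X i x.
Proof.
rewrite /line_form mulr_sumr; apply: eq_bigr => j _.
by rewrite ext_coefZ mulrCA.
Qed.

Definition coef_at S x : k^o := ext_coef x S.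

Lemma coef_at_is_linear S : linear (coef_at S).
Proof. by move=> r x y; rewrite /coef_at ext_coefD ext_coefZ. Qed.

HB.instance Definition _ X i := GRing.isLinear.Build k E k^o *:%R
  (line_form X i : E -> k^o) (line_form_is_linear X i).
HB.instance Definition _ S := GRing.isLinear.Build k E k^o *:%R
  (coef_at S) (coef_at_is_linear S).

(** The kernel of [line_form X i] alone is in general not stable under multiplication, because
    degree-one elements belong to it; removing the components of degree below two makes it a
    two-sided ideal. *)
Definition line_form_ker X i : {vspace E} :=
  (lker (linfun (line_form X i : E -> k^o)) :&:
   \bigcap_(S : {set 'I_n} | (#|S| < 2)%N) lker (linfun (coef_at S)))%VS.

Lemma mem_line_form_ker X i x :
  reflect (line_form X i x = 0 /\ low_vanish x) (x \in line_form_ker X i).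
Proof.
rewrite memv_cap memv_ker lfunE /=.
apply: (iffP andP) => -[fx0 h]; split; try exact/eqP.
  move=> S S2; move/subv_bigcapP: h => /(_ S S2).
  by rewrite -memvE memv_ker lfunE => /eqP.
rewrite memvE; apply/subv_bigcapP => S S2.
by rewrite -memvE memv_ker lfunE; apply/eqP/h.
Qed.

Lemma line_form_kerMl X i : ({:E} * line_form_ker X i <= line_form_ker X i)%VS.
Proof.
apply/prodvP => x y _ /mem_line_form_ker[fy y0].
apply/mem_line_form_ker; split; last exact: low_vanishMl.
transitivity (ext_aug x * line_form X i y); last by rewrite fy mulr0.
rewrite /line_form mulr_sumr; apply: eq_bigr => j /andP[_ nji].
by rewrite ext_coef_mul2l ?cards2 ?nji // mulrCA.
Qed.

Lemma low_vanishMr x y : low_vanish x -> low_vanish (x * y).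
Proof.
move=> x0 S S2; rewrite ext_coef_mul big1 // => T sT.
rewrite x0 ?mulr0 ?mul0r //; apply: leq_ltn_trans S2.
exact: subset_leq_card.
Qed.

Lemma line_form_kerMr X i : (line_form_ker X i * {:E} <= line_form_ker X i)%VS.
Proof.
apply/prodvP => x y /mem_line_form_ker[fx x0] _.
apply/mem_line_form_ker; split; last exact: low_vanishMr.
transitivity (line_form X i x * ext_aug y); last by rewrite fx mul0r.
rewrite /line_form mulr_suml; apply: eq_bigr => j /andP[_ nji].
by rewrite ext_coef_mul2r ?cards2 ?nji // mulrA.
Qed.

Lemma ext_linB lambda eta : ext_lin (lambda - eta) = ext_lin lambda - ext_lin eta.
Proof.
by rewrite -sumrB; apply: eq_bigr => i _; rewrite !mxE scalerBl.
Qed.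

Lemma ext_lin_delta i : ext_lin (delta_mx 0 i) = e i.
Proof.
rewrite /ext_lin (bigD1 i) //= mxE !eqxx scale1r big1 ?addr0 // => j nji.
by rewrite mxE (negPf nji) andbF scale0r.
Qed.

Lemma sum_on_delta X i : sum_on X (delta_mx 0 i : 'rV[k]_n) = (i \in X)%:R.
Proof.
rewrite /sum_on big_mkcond (bigD1 i) //= mxE !eqxx big1 ?addr0 => [|j nji].
  by case: (i \in X).
by rewrite mxE (negPf nji) andbF if_same.
Qed.

Lemma card3_split C i : #|C| = 3%N -> i \in C ->
  exists b c, [/\ i != b, i != c, b != c & C = [set i; b; c]].
Proof.
move=> C3 iC; have /cards2P[b [c [nbc eC]]] : #|C :\ i| == 2%N.
  by move: C3; rewrite (cardsD1 i) iC add1n => -[/eqP].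
have : (b \in C :\ i) && (c \in C :\ i) by rewrite eC set21 set22.
rewrite !inE ![_ == i]eq_sym => /andP[/andP[nb _] /andP[nc _]].
by exists b, c; split=> //; rewrite -setUA -eC setD1K.
Qed.

End Exterior.

(** * The line relations describing [Zspace] *)

Section Resonance.
Variables (k F : fieldType) (l n : nat) (H : arrangement F l n).
Local Notation E := (exterior k n).
Local Notation e := (ext_gen k).
Local Notation g := (OS_gen k H).
Implicit Types (i j a b c : 'I_n) (X C : {set 'I_n}).
Implicit Types (lambda eta xi : 'rV[k]_n).

(** Only three-element circuits reach degree two; there the boundary is, up to sign, a product of
    two differences of generators, evaluated by [line_form_lin]. If [i] is not in [C], both factors
    vanish at [i], or rather have zero [i]-coordinate. Otherwise take [i] as base point [a]:
    collinearity makes [b] and [c] lie in [X] together, so the two terms cancel. *)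
Lemma line_form_boundary X i C : X \in lines H -> i \in X -> circuit H C ->
  line_form X i (ext_boundary k C) = 0.
Proof.
move=> lX iX cC; have [C3|nC3] := eqVneq #|C| 3; last first.
  rewrite /line_form big1 // => j /andP[_ nji].
  by rewrite ext_coef_boundary0 ?mulr0 // cards2 nji.
have [a aC ai] : exists2 a, a \in C & i \in C -> a = i.
  have [iC|niC] := boolP (i \in C); first by exists i.
  by have /card_gt0P[a aC] : (0 < #|C|)%N; [rewrite C3 | exists a].
have [b [c [nab nac nbc eC]]] := card3_split C3 aC.
rewrite eC ext_boundary_triple // -!ext_lin_delta -!ext_linB.
rewrite line_formZ.
suff -> : line_form X i (ext_lin (delta_mx 0 b - delta_mx 0 a) *
    ext_lin (delta_mx 0 c - delta_mx 0 a) : E) = 0 by rewrite mulr0.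
rewrite line_form_lin // !linearB /= !sum_on_delta !mxE !eqxx /=.
have [iC|] := boolP (i \in C); last first.
  rewrite eC !inE !negb_or => /andP[/andP[/negPf-> /negPf->] /negPf->].
  by rewrite subrr mulr0 mul0r subrr.
have ea := ai iC; subst a; rewrite iX eqxx (negPf nab) (negPf nac).
rewrite eC in cC.
have inX b' c' : i != b' -> c' \in line_of H i b' -> b' \in X -> c' \in X.
  by move=> nib cl bX; rewrite (lines_eq_line_of lX iX bX nib).
have bc : c \in line_of H i b by rewrite -circuit_triple.
have cb : b \in line_of H i c.
  by rewrite -circuit_triple // 1?eq_sym // setUAC.
have -> : (b \in X) = (c \in X) by apply/idP/idP; apply: inX.
by rewrite mulrC subrr.
Qed.

Lemma OS_ideal_line_form X i x : X \in lines H -> i \in X ->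
  x \in OS_ideal k H -> line_form X i x = 0.
Proof.
move=> lX iX xI; suff /mem_line_form_ker[] : x \in line_form_ker k X i by [].
apply: (subvP _ _ xI); rewrite /OS_ideal.
apply: subv_trans (line_form_kerMr k X i); rewrite prodvSl //.
apply: subv_trans (line_form_kerMl k X i); rewrite prodvSr //.
apply/span_subvP => _ /imageP[C cC ->]; apply/mem_line_form_ker; split.
  exact: line_form_boundary.
move=> S S2; apply: ext_coef_boundary0.
by have := circuit_card3 cC; lia.
Qed.

Lemma OS_genC i j : g i * g j = - (g j * g i).
Proof. by rewrite /OS_gen -!rmorphM ext_gen_anti rmorphN. Qed.

Lemma OS_gen_sqr i : g i * g i = 0.
Proof. by rewrite /OS_gen -rmorphM ext_gen_sqr rmorph0. Qed.

Lemma OS_gen_triple X a b c : X \in lines H ->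
  a \in X -> b \in X -> c \in X -> (g b - g a) * (g c - g a) = 0.
Proof.
move=> lX aX bX cX.
have [->|nab] := eqVneq a b; first by rewrite subrr mul0r.
have [->|nac] := eqVneq a c; first by rewrite subrr mulr0.
have [->|nbc] := eqVneq b c.
  by rewrite mulrBl !mulrBr !OS_gen_sqr [g a * _]OS_genC sub0r subr0 subrr.
have cC : circuit H [set a; b; c].
  by rewrite circuit_triple // -(lines_eq_line_of lX aX bX nab).
have : ext_boundary k [set a; b; c] \in OS_ideal k H.
  rewrite /OS_ideal -[ext_boundary k _]mulr1 -[ext_boundary k _]mul1r.
  rewrite memv_mul ?memvf // memv_mul ?memvf // memv_span //.
  by apply/imageP; exists [set a; b; c].
rewrite ext_boundary_triple // rpredZsign -OS_pi_eq0 rmorphM !rmorphB /=.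
by move/eqP.
Qed.

(** Relative to a base point [a], each factor is [P xi] plus [sum_on X xi] times [g a]. Products of
    two [P] terms vanish by [OS_gen_triple], and the rest is [g a] times a combination of [P lambda]
    and [P eta] that the relations kill. *)
Lemma line_product X lambda eta : X \in lines H ->
  (forall i, i \in X ->
     sum_on X lambda * eta 0 i - lambda 0 i * sum_on X eta = 0) ->
  (\sum_(i in X) lambda 0 i *: g i) * (\sum_(i in X) eta 0 i *: g i) = 0.
Proof.
move=> lX rel; have [a [b [nab eX]]] := linesP lX.
have aX : a \in X by rewrite eX mem_line_ofl.
pose P xi := \sum_(i in X) xi 0 i *: (g i - g a).
have split_a xi : \sum_(i in X) xi 0 i *: g i = P xi + (sum_on X xi : k) *: g a.
  rewrite /P scaler_suml -big_split; apply: eq_bigr => i _ /=.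
  by rewrite -scalerDr subrK.
have PP : P lambda * P eta = 0.
  rewrite mulr_suml big1 // => i iX; rewrite mulr_sumr big1 // => j jX.
  by rewrite -scalerAl -scalerAr (OS_gen_triple lX) // !scaler0.
have Pa : P lambda * g a = - (g a * P lambda).
  rewrite mulr_suml mulr_sumr -sumrN; apply: eq_bigr => i _.
  rewrite -scalerAl -scalerAr -scalerN; congr (_ *: _).
  by rewrite mulrBl mulrBr OS_gen_sqr !subr0 OS_genC.
have rP : (sum_on X lambda : k) *: P eta - (sum_on X eta : k) *: P lambda = 0.
  rewrite !scaler_sumr -sumrB big1 // => i iX.
  by rewrite !scalerA -scalerBl [sum_on X eta * _]mulrC rel // scale0r.
rewrite !split_a mulrDl !mulrDr PP add0r -!scalerAl -!scalerAr OS_gen_sqr.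
rewrite !scaler0 addr0 Pa scalerN addrC !scalerAr -mulrBr.
by rewrite rP mulr0.
Qed.

(** Two distinct indices lie on exactly one common line, and the diagonal terms are zero. *)
Lemma OS_lin_lines lambda eta : OS_lin H lambda * OS_lin H eta =
  \sum_(X in lines H)
     (\sum_(i in X) lambda 0 i *: g i) * (\sum_(i in X) eta 0 i *: g i).
Proof.
pose t i j := (lambda 0 i *: g i) * (eta 0 j *: g j).
have tE i j : t i j =
    \sum_(X in lines H) if (i \in X) && (j \in X) then t i j else 0.
  have [<-|nij] := eqVneq i j.
    have -> : t i i = 0 by rewrite /t -scalerAl -scalerAr OS_gen_sqr !scaler0.
    by rewrite big1 // => X _; rewrite if_same.
  rewrite (bigD1 (line_of H i j)) ?line_of_lines //= mem_line_ofl mem_line_ofr.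
  rewrite big1 ?addr0 // => X /andP[lX nX]; case: ifP => // /andP[iX jX].
  by rewrite (lines_eq_line_of lX iX jX nij) eqxx in nX.
rewrite /OS_lin mulr_suml.
under eq_bigr => i _ do rewrite mulr_sumr (eq_bigr _ (fun j _ => tE i j)).
rewrite (eq_bigr _ (fun i _ => exchange_big _ _ _ _ _ _)) /= exchange_big /=.
apply: eq_bigr => X lX; rewrite mulr_suml [RHS]big_mkcond /=.
apply: eq_bigr => i _; rewrite mulr_sumr.
case: (i \in X) => /=; last by rewrite big1.
by rewrite [RHS]big_mkcond.
Qed.

Lemma mem_Zspace_lines lambda eta :
  reflect (forall X i, X \in lines H -> i \in X ->
             sum_on X lambda * eta 0 i - lambda 0 i * sum_on X eta = 0)
          (eta \in Zspace H lambda).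
Proof.
rewrite mem_Zspace; apply: (iffP eqP) => [z X i lX iX|rel]; last first.
  rewrite OS_lin_lines big1 // => X lX; apply: line_product => // i.
  exact: rel.
have piE xi : OS_lin H xi = OS_pi H (ext_lin xi).
  by rewrite /OS_lin linear_sum; apply: eq_bigr => j _; rewrite linearZ.
rewrite -line_form_lin //; apply: OS_ideal_line_form => //.
by rewrite -OS_pi_eq0 rmorphM /= -!piE; apply/eqP.
Qed.

End Resonance.

(** * From neighborly graphs to resonance *)

Section NeighborlyGraphs.
Variables (k F : fieldType) (l n : nat) (H : arrangement F l n).
Implicit Types (i j p q : 'I_n) (X S : {set 'I_n}).
Implicit Types (lambda eta xi : 'rV[k]_n).

Lemma block_cone (G : sgraph n) S i : block G S -> cone_vertex G i -> i \in S.
Proof.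
move=> /maxsetP[/forall_inP cS maxS] /forallP ci.
rewrite -(maxS (i |: S)) ?setU11 ?subsetUr //.
apply/forall_inP => a /setU1P aS; apply/forall_inP => b /setU1P bS.
apply/implyP => nab; case: aS bS nab => [->|aS] [->|bS] nab.
- by rewrite eqxx in nab.
- by apply: (implyP (ci b)); rewrite eq_sym.
- by rewrite adj_sym; apply: (implyP (ci a)).
- exact: (implyP (forall_inP (cS a aS) b bS)).
Qed.

Lemma line_relation_of_minors X lambda eta i :
  (forall j, j \in X -> lambda 0 i * eta 0 j - lambda 0 j * eta 0 i = 0) ->
  sum_on X lambda * eta 0 i - lambda 0 i * sum_on X eta = 0.
Proof.
move=> minors; rewrite /sum_on mulr_suml mulr_sumr.
apply/eqP; rewrite subr_eq0; apply/eqP; apply: eq_bigr => j jX.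
by apply/esym/eqP; rewrite -subr_eq0 minors.
Qed.

(** On a clique the line relation is a sum of edge minors. On a nontrivial line that is not a clique
    both sums vanish, as [lambda] and [eta] are in [Kspace]. Neighborliness makes every two-point
    line a clique. *)
Lemma Zgraph_sub_Zspace (G : sgraph n) lambda :
  neighborly H G -> lambda \in Kspace k H G ->
  (Zgraph H G lambda <= Zspace H lambda)%VS.
Proof.
move=> nG /mem_Kspace lK; apply/subvP => eta /mem_Zgraph[/mem_Kspace eK minors].
apply/mem_Zspace_lines => X i lX iX.
have [cX|ncX] := boolP (clique G X).
  apply: line_relation_of_minors => j jX.
  have [->|nij] := eqVneq i j; first by rewrite subrr.
  exact/minors/(implyP (forall_inP (forall_inP cX i iX) j jX)).
have [X3|X2] := boolP (3 <= #|X|)%N.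
  have XN : X \in noncliques H G by rewrite !inE in lX *; rewrite lX X3.
  by rewrite /sum_on lK // eK // mul0r mulr0 subrr.
(* A block through [a] has |X :&: U| - 1 = 1 point of [X] when [G a b] fails, *)
(* so a two-element line is a clique by neighborliness.                       *)
have [a [b [nab eX]]] := linesP lX.
have aX : a \in X by rewrite eX mem_line_ofl.
have bX : b \in X by rewrite eX mem_line_ofr.
have {}eX : X = [set a; b].
  apply/esym/eqP; rewrite eqEcard subUset !sub1set aX bX cards2 nab /=.
  by rewrite -leqNgt in X2.
case/negP: ncX; have nGab : ~~ G a b -> [set a; b] \subset noncone G.
  move=> nGab; apply/subsetP => m /set2P[]->; rewrite inE; apply/negP.
    by move/forallP/(_ b)/implyP; rewrite eq_sym nab (negPf nGab) => /(_ isT).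
  by move/forallP/(_ a)/implyP; rewrite nab adj_sym (negPf nGab) => /(_ isT).
have sub_clique S : X \subset S -> clique G S -> clique G X.
  move=> /subsetP sXS /forall_inP cS; apply/forall_inP => u uX.
  apply/forall_inP => v vX; exact: (forall_inP (cS u (sXS _ uX)) v (sXS _ vX)).
have [Gab|/nGab sU] := boolP (G a b).
  rewrite eX; apply/forall_inP => u /set2P uX; apply/forall_inP => v /set2P vX.
  apply/implyP; case: uX vX => -> [] ->; rewrite ?eqxx ?Gab // adj_sym Gab //.
have [S bS aS] : {S | block G S & [set a] \subset S}.
  apply: maxset_exists; apply/forall_inP => u /set1P->.
  by apply/forall_inP => v /set1P->; rewrite eqxx.
have XU : X :&: noncone G = [set a; b] by rewrite eX; apply/setIidPl.
apply: (sub_clique S); last by case/maxsetP: bS.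
apply: nG => //; rewrite XU cards2 nab // card_gt0.
by apply/set0Pn; exists a; rewrite inE set21 -sub1set.
Qed.

(** * The neighborly graph attached to a resonant vector *)

Section ResonanceGraph.
Variable lambda : 'rV[k]_n.
Local Notation Z := (Zspace H lambda).

Definition resonance_adj i j : bool :=
  (i != j) && (Z <= lker (linfun (minor2 lambda i j)))%VS.

Lemma resonance_adjP i j :
  reflect (i != j /\ forall eta, eta \in Z -> lambda 0 i * eta 0 j = lambda 0 j * eta 0 i)
          (resonance_adj i j).
Proof.
apply: (iffP andP) => -[nij h]; split => //.
  move=> eta /(subvP h); rewrite memv_ker lfunE => /eqP /= e.
  by apply/eqP; rewrite -subr_eq0; apply/eqP.
apply/subvP => eta /h e; rewrite memv_ker lfunE /= /minor2 e.
by rewrite subrr.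
Qed.

Lemma resonance_adj_sym : symmetric resonance_adj.
Proof.
by move=> i j; apply/resonance_adjP/resonance_adjP => -[nij h];
  split=> [|eta /h->//]; rewrite eq_sym.
Qed.

Lemma resonance_adj_irr : irreflexive resonance_adj.
Proof. by move=> i; rewrite /resonance_adj eqxx. Qed.

Definition resonance_graph := SGraph resonance_adj_sym resonance_adj_irr.
Local Notation G := resonance_graph.

(* On a line [X] every [xi \in Z] satisfies [lambda_X xi = xi_X lambda], so   *)
(* [lambda] and [xi] are proportional on [X] unless both sums vanish.         *)
Lemma sum_on_nonclique X eta : X \in lines H -> ~~ clique G X ->
  eta \in Z -> sum_on X eta = 0.
Proof.
move=> lX ncX etaZ.
have rel xi i : xi \in Z -> i \in X ->
    sum_on X lambda * xi 0 i = lambda 0 i * sum_on X xi.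
  by move=> /mem_Zspace_lines h iX; apply/eqP; rewrite -subr_eq0 h.
have cliqueI : (forall i j, i \in X -> j \in X -> i != j -> forall xi, xi \in Z ->
    lambda 0 i * xi 0 j = lambda 0 j * xi 0 i) -> clique G X.
  move=> h; apply/forall_inP => i iX; apply/forall_inP => j jX.
  by apply/implyP => nij; apply/resonance_adjP; split=> //; apply: h.
have [lX0|nlX] := eqVneq (sum_on X lambda) 0; last first.
  case/negP: ncX; apply: cliqueI => i j iX jX _ xi xiZ.
  by apply: (mulfI nlX); rewrite mulrCA rel // [RHS]mulrCA rel //; ring.
apply/eqP; apply: contraNT ncX => neX; apply: cliqueI => i j iX jX _ xi _.
have l0 m : m \in X -> lambda 0 m = 0.
  move=> mX; apply: (mulIf neX); rewrite mul0r -rel // lX0 mul0r //.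
by rewrite !l0 // !mul0r.
Qed.

Lemma Zspace_sub_Kspace : (Z <= Kspace k H G)%VS.
Proof.
apply/subvP => eta etaZ; apply/mem_Kspace => X.
rewrite !inE => /andP[/andP[lX _] ncX]; apply: sum_on_nonclique => //.
by rewrite inE.
Qed.

Lemma Zspace_sub_Zgraph : (Z <= Zgraph H G lambda)%VS.
Proof.
apply/subvP => eta etaZ; apply/mem_Zgraph; split.
  exact: (subvP Zspace_sub_Kspace).
by move=> i j /resonance_adjP[_ ->//]; rewrite subrr.
Qed.

Lemma lambda_Zspace : lambda \in Z.
Proof. by apply/mem_Zspace_lines => X i _ _; rewrite mulrC subrr. Qed.

(** If every vector of [Z], [lambda] included, vanished at [q], all minors at [q] would vanish and
    [q] would be a cone vertex. *)
Lemma noncone_coord q : q \in noncone G -> exists2 xi, xi \in Z & xi 0 q != 0.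
Proof.
rewrite inE => /forallPn[j]; rewrite negb_imply => /andP[njq].
rewrite /= /resonance_adj eq_sym njq /= => /subvPn[xi xiZ].
rewrite memv_ker lfunE /= /minor2 => minor.
have [lq|nlq] := eqVneq (lambda 0 q) 0; last by exists lambda; rewrite ?lambda_Zspace.
by exists xi => //; apply: contraNneq minor => ->; rewrite lq mul0r mulr0 subrr.
Qed.

Definition proportional i j :=
  forall xi, xi \in Z -> lambda 0 i * xi 0 j = lambda 0 j * xi 0 i.

Lemma proportional_sym i j : proportional i j -> proportional j i.
Proof. by move=> h xi xiZ; rewrite h. Qed.

Lemma clique_proportional S i j :
  clique G S -> i \in S -> j \in S -> proportional i j.
Proof.
move=> /forall_inP cS iS jS; have [->//|nij] := eqVneq i j.
by have /resonance_adjP[] := implyP (forall_inP (cS i iS) j jS) nij.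
Qed.

Lemma cone_proportional i j : cone_vertex G i -> proportional i j.
Proof.
move=> /forallP ci; have [->//|nji] := eqVneq j i.
by have /resonance_adjP[] := implyP (ci j) nji.
Qed.

(** If [lambda 0 q] is nonzero it can be cancelled. If it is zero, a vector of [Z] that is nonzero
    at [q] forces [lambda] to vanish at [i] and [j]. *)
Lemma proportional_trans q i j : q \in noncone G ->
  proportional i q -> proportional q j -> proportional i j.
Proof.
move=> /noncone_coord[zeta zZ nz] iq qj xi xiZ.
have [lq|nlq] := eqVneq (lambda 0 q) 0; last first.
  by apply: (mulfI nlq); rewrite mulrCA qj // mulrCA iq // mulrCA.
have li : lambda 0 i = 0 by apply: (mulIf nz); rewrite iq // lq !mul0r.
have lj : lambda 0 j = 0 by apply: (mulIf nz); rewrite -qj // lq !mul0r.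
by rewrite li lj !mul0r.
Qed.

(** A point [p] of [X] outside the block [S] is the only non-cone point of [X] outside [S]. All
    other points of [X] are proportional to a non-cone point [q] of [S]. If [X] is not a clique,
    [sum_on X] vanishes on [Z], so the coordinate at [p] is minus the sum of the others and [p] is
    proportional to [q] too. Transitivity through [q] then makes [p |: S] a clique, against
    maximality. *)
Lemma neighborly_resonance_graph : neighborly H G.
Proof.
move=> X S lX XU2 bS XUS; apply/subsetP => p pX.
apply: contraLR isT => npS.
have /maxsetP[cS maxS] := bS.
have coneS i : i \notin S -> i \in noncone G.
  by rewrite inE; apply: contraNN; apply: block_cone.
have pXU : p \in X :&: noncone G by rewrite inE pX coneS.
have eXU : (X :&: noncone G) :\ p \subset S.
  have sub : X :&: noncone G :&: S \subset (X :&: noncone G) :\ p.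
    apply/subsetP => m mXUS; rewrite !in_setD1.
    move: mXUS; rewrite !in_setI => /andP[-> mS]; rewrite andbT.
    by apply: contraNneq npS => <-.
  suff /eqP <- : X :&: noncone G :&: S == (X :&: noncone G) :\ p by exact: subsetIr.
  rewrite eqEcard sub /=; move: XUS.
  by rewrite (cardsD1 p (X :&: noncone G)) pXU add1n subn1.
have [q] : exists q, q \in (X :&: noncone G) :\ p.
  apply/set0Pn; rewrite -card_gt0.
  by move: XU2; rewrite (cardsD1 p (X :&: noncone G)) pXU.
move=> qXU; have qS := subsetP eXU q qXU.
move: qXU; rewrite !in_setD1 in_setI => /and3P[nqp qX qU].
have jq j : j \in X -> j != p -> proportional j q.
  move=> jX njp; have [jU|] := boolP (j \in noncone G).
    apply: (clique_proportional cS) => //.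
    by apply: (subsetP eXU); rewrite in_setD1 njp in_setI jX.
  by rewrite inE negbK => cj; apply: cone_proportional.
have qp : proportional q p.
  have [cX|ncX] := boolP (clique G X); first exact: (clique_proportional cX).
  move=> xi xiZ.
  have sum0 eta : eta \in Z -> eta 0 p = - \sum_(j in X | j != p) eta 0 j.
    move=> etaZ; apply/eqP; rewrite -addr_eq0.
    have := sum_on_nonclique lX ncX etaZ; rewrite /sum_on (bigD1 p) //=.
    by move=> ->.
  rewrite (sum0 _ xiZ) (sum0 _ lambda_Zspace) mulrN mulNr; congr (- _).
  rewrite mulr_sumr mulr_suml; apply: eq_bigr => j /andP[jX njp].
  by rewrite jq.
(* Replacing [S] by [p |: S] makes [npS] absurd; what remains is the side condition that [p |: S] is
   a clique. *)
rewrite -(maxS (p |: S)) ?setU11 ?subsetUr // in npS.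
apply/forall_inP => a aS; apply/forall_inP => b bS'; apply/implyP => nab.
apply/resonance_adjP; split=> //.
have pr c : c \in p |: S -> proportional c q.
  move=> /setU1P[->|cS']; first exact: proportional_sym.
  exact: (clique_proportional cS).
by apply: (proportional_trans qU (pr a aS)); apply/proportional_sym/pr.
Qed.

End ResonanceGraph.

(** * Equality of the two sets *)

Lemma resonanceE :
  resonance k H = (\bigcup_(G in neighborly_graphs k H) Vset k H G)%classic.
Proof.
apply/seteqP; split=> lambda; rewrite /resonance /=.
  move=> dZ; exists (resonance_graph lambda).
    split; first exact: neighborly_resonance_graph.
    exact: leq_trans dZ (dimvS (Zspace_sub_Kspace lambda)).
  split; first exact: (subvP (Zspace_sub_Kspace lambda) _ (lambda_Zspace lambda)).
  exact: leq_trans dZ (dimvS (Zspace_sub_Zgraph lambda)).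
move=> [G [nG _] [lK dZ]].
exact: leq_trans dZ (dimvS (Zgraph_sub_Zspace nG lK)).
Qed.

End NeighborlyGraphs.

Theorem corollary2p14 (R : realType) (k : fieldType) (l n : nat)
    (A : arrangement R[i] l n) :
  resonance k A = (\bigcup_(G in neighborly_graphs k A) Vset k A G)%classic.
Proof. exact: resonanceE. Qed.
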